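(* Let $R$ be an associative unital algebra over $\mathbb C$ and let $T(z)$ be an $n\times n$ Lax matrix of Yangian type over $R$. Let $QH_k(z)$ ($0\le k\le n$) be defined by $$\det{}^{column}\bigl(t-T(z)e^{-\partial_z}\bigr)=\sum_{k=0}^{n}t^k\,QH_k(z)\,e^{(k-n)\partial_z},$$ where $t$ is a formal variable commuting with everything, and define the quantum powers $$T^{[p]}(z)=T(z+p)\,T(z+p-1)\cdots T(z+1)=e^{p\partial_z}\bigl(T(z)e^{-\partial_z}\bigr)^p,\qquad T^{[0]}(z)=\mathrm{Id}.$$ Then $$\sum_{k=0}^{n}QH_k(z+n)\,T^{[k]}(z)=0 .$$
   Context: An $n\times n$ matrix $T(z)$ whose entries are $R$-valued functions of the formal parameter $z$ (elements of $R((z^{-1}))$, or rational functions of $z$ with coefficients in $R$) is called a Lax matrix of Yangian type if $$[T_{ij}(u),T_{kl}(v)]=\frac{1}{u-v}\bigl(T_{kj}(u)T_{il}(v)-T_{kj}(v)T_{il}(u)\bigr)$$ for all $i,j,k,l$. The shift operator satisfies $e^{a\partial_z}f(z)=f(z+a)e^{a\partial_z}$ and commutes with $R$; shifts $f(z+a)$ of elements of $R((z^{-1}))$ are expanded in $z^{-1}$. The column determinant is $\det^{column}N=\sum_{\sigma\in S_n}(-1)^\sigma N_{\sigma(1),1}N_{\sigma(2),2}\cdots N_{\sigma(n),n}$. The elements $QH_k(z)$ do not involve $\partial_z$. The product $QH_k(z+n)T^{[k]}(z)$ means the matrix $T^{[k]}(z)$ with every entry multiplied on the left by $QH_k(z+n)$.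 *)

(* Defs.v *)
From HB Require Import structures.
From mathcomp Require Import all_boot all_order all_algebra.
From mathcomp Require Import boolp classical_sets functions fsbigop.
From mathcomp Require Import perm reals complex.
From mathcomp Require Import zify ring.

Set Implicit Arguments.
Unset Strict Implicit.
Unset Printing Implicit Defensive.

Import Order.TTheory GRing.Theory Num.Theory.

Local Open Scope ring_scope.

(* An element of R((z^-1)): [lcoef f m] is the coefficient of z^m, so the     *)
(* support is bounded above. A rational function P(z)/q(z), with P in R[z]    *)
(* and q a nonzero complex polynomial, is identified with its expansion at    *)
(* infinity, which is compatible with products and shifts.                    *)
Record laurent (R : nzRingType) := Laurent {
  lcoef :> int -> R;
  lcoef_bounded : exists N : int, forall m, N < m -> lcoef m = 0 }.

HB.instance Definition _ (R : nzRingType) := gen_eqMixin (laurent R).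
HB.instance Definition _ (R : nzRingType) := gen_choiceMixin (laurent R).

Section LaurentRing.
Variable R : nzRingType.
Implicit Types f g h : laurent R.

Definition lbound (f : int -> R) (N : int) := forall m, N < m -> f m = 0.

Lemma laurentP f g : (forall m, f m = g m) -> f = g.
Proof.
case: f g => [f Hf] [g Hg] /= /funext fg.
by subst g; congr Laurent; apply: Prop_irrelevance.
Qed.

Lemma lbound_le (f : int -> R) (N M : int) : N <= M -> lbound f N -> lbound f M.
Proof. by move=> NM fN m Mm; apply: fN; apply: le_lt_trans Mm. Qed.

Lemma lbound2 f g : exists N, lbound f N /\ lbound g N.
Proof.
have [[N fN] [M gM]] := (lcoef_bounded f, lcoef_bounded g).
by exists (Num.max N M); split; [apply: lbound_le fN|apply: lbound_le gM];
  rewrite le_max lexx ?orbT.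
Qed.

Lemma lzero_bounded : exists N, lbound (fun=> 0 : R) N.
Proof. by exists 0. Qed.
Definition lzero := Laurent lzero_bounded.

Lemma ladd_bounded f g : exists N, lbound (fun m => f m + g m) N.
Proof.
have [N [fN gN]] := lbound2 f g.
by exists N => m Nm; rewrite fN // gN // addr0.
Qed.
Definition ladd f g := Laurent (ladd_bounded f g).

Lemma lopp_bounded f : exists N, lbound (fun m => - f m) N.
Proof.
have [N fN] := lcoef_bounded f.
by exists N => m Nm; rewrite fN // oppr0.
Qed.
Definition lopp f := Laurent (lopp_bounded f).

Fact laddA : associative ladd.
Proof. by move=> f g h; apply: laurentP => m /=; rewrite addrA. Qed.
Fact laddC : commutative ladd.
Proof. by move=> f g; apply: laurentP => m /=; rewrite addrC. Qed.
Fact ladd0 : left_id lzero ladd.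
Proof. by move=> f; apply: laurentP => m /=; rewrite add0r. Qed.
Fact laddN : left_inverse lzero lopp ladd.
Proof. by move=> f; apply: laurentP => m /=; rewrite addNr. Qed.

HB.instance Definition _ :=
  GRing.isZmodule.Build (laurent R) laddA laddC ladd0 laddN.

Definition lmul_fun f g (m : int) : R :=
  \sum_(i \in [set: int]) f i * g (m - i).

Lemma fsum_seq (I : choiceType) (r : seq I) (F : I -> R) : uniq r ->
  (forall i, i \notin r -> F i = 0) ->
  \sum_(i \in [set: I]) F i = \sum_(i <- r) F i.
Proof.
move=> ur F0; rewrite (fsbigE r) //=; last by move=> i _; apply: F0.
by apply: eq_bigl => i; rewrite in_setT.
Qed.

Lemma fsum_point (I : choiceType) (F : I -> R) (i : I) :
  (forall j, j != i -> F j = 0) -> \sum_(j \in [set: I]) F j = F i.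
Proof.
by move=> F0; rewrite (@fsum_seq _ [:: i]) ?big_seq1 // => j; rewrite inE => /F0.
Qed.

Lemma lmul_funE f g N M (k : nat) : lbound f N -> lbound g M ->
  lmul_fun f g (N + M - k%:Z) =
  \sum_(j < k.+1) f (N - j%:Z) * g (M - (k - j)%N%:Z).
Proof.
move=> fN gM.
rewrite /lmul_fun (@fsum_seq _ [seq N - j%:Z | j <- iota 0 k.+1]).
- rewrite -(big_mkord xpredT (fun j => f (N - j%:Z) * g (M - (k - j)%N%:Z))).
  rewrite big_map /index_iota subn0 big_seq [RHS]big_seq.
  apply: eq_bigr => j.
  by rewrite mem_iota => jk; congr (_ * g _); lia.
- by rewrite map_inj_uniq ?iota_uniq // => x y; lia.
- move=> i ni; case: (ltrP N i) => [/fN ->|iN]; first by rewrite mul0r.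
  rewrite gM ?mulr0 //; rewrite ltNge; apply/negP => le.
  move/negP: ni; apply; apply/mapP; exists `|N - i|%N; last by lia.
  by rewrite mem_iota; lia.
Qed.

Lemma lmul_fun_bound f g N M :
  lbound f N -> lbound g M -> lbound (lmul_fun f g) (N + M).
Proof.
move=> fN gM m lt; rewrite /lmul_fun fsbig1 // => i _.
case: (ltrP N i) => [/fN ->|iN]; first by rewrite mul0r.
by rewrite gM ?mulr0 //; lia.
Qed.

Lemma lmul_bounded f g : exists N, lbound (lmul_fun f g) N.
Proof.
have [[N fN] [M gM]] := (lcoef_bounded f, lcoef_bounded g).
by exists (N + M); apply: lmul_fun_bound.
Qed.
Definition lmul f g := Laurent (lmul_bounded f g).

Lemma lmon_bounded (m : int) (c : R) :
  exists N, lbound (fun i => if i == m then c else 0) N.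
Proof. by exists m => i; case: eqVneq => // ->; rewrite ltxx. Qed.
(* The monomial c z^m. *)
Definition lmon m c := Laurent (lmon_bounded m c).

Lemma laurent_ext N f g : lbound f N -> lbound g N ->
  (forall k : nat, f (N - k%:Z) = g (N - k%:Z)) -> f = g.
Proof.
move=> fN gN fg; apply: laurentP => m.
case: (ltrP N m) => [lt|le]; first by rewrite fN // gN.
by have -> : m = N - `|N - m|%N%:Z by lia.
Qed.

Definition ltrunc (f : int -> R) N K : {poly R} := \poly_(j < K) f (N - j%:Z).

Lemma lmul_trunc f g N M K k : (k < K)%N -> lbound f N -> lbound g M ->
  lmul_fun f g (N + M - k%:Z) = (ltrunc f N K * ltrunc g M K)`_k.
Proof.
move=> kK fN gM; rewrite lmul_funE // coefM; apply: eq_bigr => j _.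
by rewrite !coef_poly !ifT //; have := ltn_ord j; lia.
Qed.

Fact lmulA : associative lmul.
Proof.
move=> f g h.
have [[N fN] [[M gM] [P hP]]] :=
  (lcoef_bounded f, (lcoef_bounded g, lcoef_bounded h)).
have fgb := lmul_fun_bound fN gM; have ghb := lmul_fun_bound gM hP.
apply: (@laurent_ext (N + M + P)) => [||k] /=.
- by rewrite -addrA; apply: lmul_fun_bound.
- exact: lmul_fun_bound.
rewrite (@lmul_trunc (lmul f g) _ _ _ k.+1) // -[N + M + P]addrA.
rewrite (@lmul_trunc _ (lmul g h) _ _ k.+1) //.
transitivity (ltrunc f N k.+1 * (ltrunc g M k.+1 * ltrunc h P k.+1))`_k.
  rewrite !coefM; apply: eq_bigr => j _; congr (_ * _).
  have lt : (k - j < k.+1)%N by lia.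
  by rewrite {1}/ltrunc coef_poly lt -lmul_trunc.
rewrite mulrA !coefM; apply: eq_bigr => j _; congr (_ * _).
by rewrite {3}/ltrunc coef_poly ltn_ord -lmul_trunc.
Qed.

Fact lmul1 : left_id (lmon 0 1) lmul.
Proof.
move=> f; apply: laurentP => m /=; rewrite /lmul_fun (@fsum_point _ _ 0).
  by rewrite /= mul1r subr0.
by move=> j /negPf j0 /=; rewrite j0 mul0r.
Qed.

Fact lmulr1 : right_id (lmon 0 1) lmul.
Proof.
move=> f; apply: laurentP => m /=; rewrite /lmul_fun (@fsum_point _ _ m).
  by rewrite /= subrr eqxx mulr1.
by move=> j /negPf jm /=; rewrite subr_eq0 eq_sym jm mulr0.
Qed.

Fact lmulDl : left_distributive lmul ladd.
Proof.
move=> f g h; have [[N [fN gN]] [M hM]] := (lbound2 f g, lcoef_bounded h).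
have fgN : lbound (ladd f g) N by move=> m Nm /=; rewrite fN // gN // addr0.
apply: (@laurent_ext (N + M)) => [||k] /=.
- exact: lmul_fun_bound.
- by move=> m Nm /=; rewrite !(@lmul_fun_bound _ _ N M) ?addr0.
rewrite !lmul_funE // -big_split; apply: eq_bigr => j _ /=.
by rewrite mulrDl.
Qed.

Fact lmulDr : right_distributive lmul ladd.
Proof.
move=> h f g; have [[N [fN gN]] [M hM]] := (lbound2 f g, lcoef_bounded h).
have fgN : lbound (ladd f g) N by move=> m Nm /=; rewrite fN // gN // addr0.
apply: (@laurent_ext (M + N)) => [||k] /=.
- exact: lmul_fun_bound.
- by move=> m Nm /=; rewrite !(@lmul_fun_bound _ _ M N) ?addr0.
rewrite !lmul_funE // -big_split; apply: eq_bigr => j _ /=.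
by rewrite mulrDr.
Qed.

Fact lone_neq0 : lmon 0 1 != 0 :> laurent R.
Proof.
apply/eqP => /(congr1 (fun f : laurent R => f 0)) /= /eqP.
by rewrite oner_eq0.
Qed.

HB.instance Definition _ := GRing.Zmodule_isNzRing.Build (laurent R)
  lmulA lmul1 lmulr1 lmulDl lmulDr lone_neq0.

End LaurentRing.

(* The coefficient m (m - 1) ... (m - j + 1) / j! of the binomial series, for *)
(* an exponent m of either sign.                                              *)
Definition binz (m : int) (j : nat) : int :=
  match m with
  | Posz n => 'C(n, j)%:Z
  | Negz n => (-1) ^+ j * 'C(n + j, j)%:Z
  end.

Lemma binz0 m : binz m 0 = 1.
Proof. by case: m => n; rewrite /binz ?addn0 bin0 // expr0 mul1r. Qed.

Lemma binzS m j : binz (m + 1) j.+1 = binz m j.+1 + binz m j.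
Proof.
case: m => [n|[|n]].
- have -> : Posz n + 1 = n.+1%:Z by lia.
  by rewrite /= binS PoszD.
- by rewrite /= !add0n !binn !mulr1 exprS mulN1r addNr.
have -> : Negz n.+1 + 1 = Negz n by lia.
rewrite /= addSn binS addSnnS exprS.
by rewrite PoszD; ring.
Qed.

Lemma binz_down m j : binz m j.+1 * j.+1%:Z = binz m j * (m - j%:Z).
Proof.
case: m => n /=.
  have [jn|nj] := leqP j n; last by rewrite !bin_small //; lia.
  by rewrite subzn // -!PoszM mulnC mul_bin_left mulnC.
have := mul_bin_diag (n + j.+1) j.
have := mul_bin_down (n + j.+1) j.
rewrite addnS /= exprS NegzE => h1 h2.
have -> : (-1) * (-1) ^+ j * 'C((n + j).+1, j.+1)%:Z * j.+1%:Z =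
  - ((-1) ^+ j * ('C((n + j).+1, j.+1) * j.+1)%N%:Z) by rewrite PoszM; ring.
have -> : (-1) ^+ j * 'C(n + j, j)%:Z * (- n.+1%:Z - j%:Z) =
  - ((-1) ^+ j * ((n + j).+1 * 'C(n + j, j))%N%:Z).
  rewrite PoszM; have -> : ((n + j).+1)%:Z = n.+1%:Z + j%:Z by lia.
  by ring.
by rewrite h2 mulnC.
Qed.

Lemma binz_comp m i j :
  binz m j * binz (m - j%:Z) i = binz m (i + j) * 'C(i + j, i)%:Z.
Proof.
elim: i => [|i IH]; first by rewrite binz0 add0n bin0.
apply: (@mulIf _ i.+1%:Z) => //.
rewrite -mulrA binz_down mulrA IH addSn.
have -> : binz m (i + j).+1 * 'C((i + j).+1, i.+1)%:Z * i.+1%:Z =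
  binz m (i + j).+1 * (i.+1 * 'C((i + j).+1, i.+1))%N%:Z by rewrite PoszM; ring.
rewrite -mul_bin_diag PoszM mulrA binz_down.
have -> : m - j%:Z - i%:Z = m - (i + j)%N%:Z by lia.
by ring.
Qed.

Lemma binz_Vandermonde m n j :
  \sum_(p < j.+1) binz m p * binz n (j - p) = binz (m + n) j.
Proof.
pose V m j := \sum_(p < j.+1) binz m p * binz n (j - p).
have V0 x : V x 0%N = 1 by rewrite /V big_ord1 !binz0.
have VS x i : V (x + 1) i.+1 = V x i.+1 + V x i.
  rewrite /V big_ord_recl [X in _ = X + _]big_ord_recl /= !binz0 -addrA.
  congr (_ + _); rewrite -big_split /=; apply: eq_bigr => p _.
  by rewrite /bump /= !add1n binzS subSS mulrDl.
rewrite -/(V m j).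
elim/int_rect: m j => [j|x IH j|x IH j].
- rewrite /V big_ord_recl binz0 mul1r subn0 big1 ?addr0 ?add0r // => p _.
  by rewrite /= /bump /= mul0r.
- rewrite -addn1 PoszD; case: j => [|j]; first by rewrite V0 binz0.
  by rewrite VS !IH addrAC binzS.
- elim: j => [|j IHj]; first by rewrite V0 binz0.
  have := VS (- x.+1%:Z) j; have := binzS (- x.+1%:Z + n) j.
  have -> : - x.+1%:Z + n + 1 = - x%:Z + n by lia.
  have -> : - x.+1%:Z + 1 = - x%:Z by lia.
  by rewrite IH IHj => -> /addIr.
Qed.

Section Shift.
Variable R : nzRingType.
Implicit Types f g : laurent R.

(* The coefficient of z^k in f(z + a), where each (z + a)^m is expanded as    *)
(* the sum over j >= 0 of binz m j * a^j * z^(m - j).                         *)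
Definition shift_fun (a : int) f (k : int) : R :=
  \sum_(j \in [set: nat]) f (k + j%:Z) *~ (binz (k + j%:Z) j * a ^+ j).

Lemma shift_coef a f N (k : nat) : lbound f N ->
  shift_fun a f (N - k%:Z) =
  \sum_(s < k.+1) f (N - s%:Z) *~ (binz (N - s%:Z) (k - s) * a ^+ (k - s)).
Proof.
move=> fN; rewrite /shift_fun (fsum_seq (r := index_iota 0 k.+1)).
- rewrite big_mkord (reindex_inj rev_ord_inj) /=; apply: eq_bigr => s _.
  rewrite subSS; have -> : N - k%:Z + (k - s)%N%:Z = N - s%:Z; last by [].
  by have := ltn_ord s; lia.
- exact: iota_uniq.
by move=> j; rewrite mem_index_iota => nj; rewrite fN ?mul0rz //; lia.
Qed.

Lemma shift_bound a f N : lbound f N -> lbound (shift_fun a f) N.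
Proof.
by move=> fN m Nm; rewrite /shift_fun fsbig1 // => j _; rewrite fN ?mul0rz //; lia.
Qed.

Lemma shift_bounded a f : exists N, lbound (shift_fun a f) N.
Proof.
by have [N fN] := lcoef_bounded f; exists N; apply: shift_bound.
Qed.
Definition shift a f := Laurent (shift_bounded a f).

Lemma shiftD a : {morph shift a : f g / f + g}.
Proof.
move=> f g; have [N [fN gN]] := lbound2 f g.
have fgN : lbound (f + g) N by move=> k Nk /=; rewrite fN // gN // addr0.
apply: (@laurent_ext _ N) => [||k].
- exact: (@shift_bound a (f + g)).
- by move=> m Nm /=; rewrite !(@shift_bound _ _ N) ?addr0.
rewrite /= (@shift_coef a (f + g) N) // !(@shift_coef _ _ N) //.
by rewrite -big_split; apply: eq_bigr => j _ /=; rewrite mulrzDl.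
Qed.

Lemma sum_triangle (V : zmodType) k (F : nat -> nat -> V) :
  \sum_(s < k.+1) \sum_(r < s.+1) F r (s - r)%N =
  \sum_(r < k.+1) \sum_(l < (k - r).+1) F r l.
Proof.
have H (s : 'I_k.+1) : \sum_(r < s.+1) F r (s - r)%N =
    \sum_(r < k.+1 | (r < s.+1)%N) F r (s - r)%N.
  exact: (big_ord_widen _ (fun r => F r (s - r)%N)).
rewrite (eq_bigr _ (fun s _ => H s)) (exchange_big_dep xpredT) //=.
apply: eq_bigr => r _.
rewrite -(big_mkord (fun s => (r < s.+1)%N) (fun s => F r (s - r)%N)).
rewrite -(big_mkord xpredT (F r)).
rewrite (big_cat_nat _ (n := r)) //=; last by have := ltn_ord r; lia.
rewrite big_nat_cond big1 ?add0r; last by move=> i; lia.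
rewrite -{1}[nat_of_ord r]add0n big_addn subSn; last by have := ltn_ord r; lia.
by apply: eq_big => i; [lia|rewrite addnK].
Qed.

Lemma shiftM a f g : shift a (f * g) = shift a f * shift a g.
Proof.
have [[N fN] [M gM]] := (lcoef_bounded f, lcoef_bounded g).
have fgb := lmul_fun_bound fN gM.
have sfb := @shift_bound a f N fN; have sgb := @shift_bound a g M gM.
apply: (@laurent_ext _ (N + M)) => [||k].
- exact: (@shift_bound a (f * g)).
- exact: (@lmul_fun_bound _ (shift a f) (shift a g)).
rewrite -[LHS]/(shift_fun a (f * g) _) (@shift_coef a (f * g)) //.
rewrite -[RHS]/(lmul_fun (shift a f) (shift a g) _) lmul_funE //.
pose c m j := binz m j * a ^+ j.
transitivity (\sum_(s < k.+1) \sum_(i < s.+1)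
    (f (N - i%:Z) * g (M - (s - i)%N%:Z)) *~
       c (N + M - (i + (s - i))%N%:Z) (k - (i + (s - i)))%N).
  apply: eq_bigr => s _.
  rewrite -[lcoef (f * g) _]/(lmul_fun f g _) lmul_funE // mulrz_suml.
  by apply: eq_bigr => i _; rewrite subnKC //; have := ltn_ord i; lia.
rewrite (@sum_triangle _ k (fun i l => (f (N - i%:Z) * g (M - l%:Z)) *~
       c (N + M - (i + l)%N%:Z) (k - (i + l))%N)).
transitivity (\sum_(s < k.+1) \sum_(i < s.+1) \sum_(l < (k - s).+1)
   (f (N - i%:Z) * g (M - l%:Z)) *~
     (c (N - i%:Z) (s - i)%N * c (M - l%:Z) (k - s - l)%N)); last first.
  apply: eq_bigr => s _; rewrite /= !shift_coef // mulr_suml.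
  apply: eq_bigr => i _; rewrite mulr_sumr; apply: eq_bigr => l _.
  by rewrite mulrzAl mulrzAr -mulrzA mulrC.
pose F i p := \sum_(l < (k - (i + p)).+1)
   (f (N - i%:Z) * g (M - l%:Z)) *~
     (c (N - i%:Z) p * c (M - l%:Z) (k - (i + p) - l)%N).
transitivity (\sum_(s < k.+1) \sum_(i < s.+1) F i (s - i)%N); last first.
  apply: eq_bigr => s _; apply: eq_bigr => i _.
  by rewrite /F subnKC //; have := ltn_ord i; lia.
rewrite sum_triangle; apply: eq_bigr => i _.
pose G p l := (f (N - i%:Z) * g (M - l%:Z)) *~
     (c (N - i%:Z) p * c (M - l%:Z) (k - i - (l + p))%N).
transitivity (\sum_(p < (k - i).+1) \sum_(l < (k - i - p).+1) G p l); last first.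
  apply: eq_bigr => p _; rewrite /F subnDA; apply: eq_bigr => l _.
  by rewrite /G; congr (_ *~ (_ * c _ _)); lia.
have -> : \sum_(p < (k - i).+1) \sum_(l < (k - i - p).+1) G p l =
  \sum_(l < (k - i).+1) \sum_(p < (k - i - l).+1) G p l.
  rewrite -!(@sum_triangle _ (k - i)%N G) -(@sum_triangle _ _ (fun l p => G p l)).
  apply: eq_bigr => s _; rewrite (reindex_inj rev_ord_inj) /=.
  apply: eq_bigr => j _; rewrite subSS; congr G.
  by have := ltn_ord j; lia.
apply: eq_bigr => l _; rewrite -mulrz_sumr; congr (_ *~ _).
have -> : N + M - (i + l)%N%:Z = (N - i%:Z) + (M - l%:Z) by lia.
rewrite /c -binz_Vandermonde mulr_suml subnDA; apply: eq_bigr => p _.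
rewrite subnDA; set x := (k - i - l)%N.
have -> : a ^+ x = a ^+ p * a ^+ (x - p) by rewrite -exprD subnKC //; have := ltn_ord p; lia.
by ring.
Qed.

Lemma shift_shift a b f : shift a (shift b f) = shift (a + b) f.
Proof.
have [N fN] := lcoef_bounded f.
apply: (@laurent_ext _ N) => [||k].
- by apply: (@shift_bound a (shift b f)); apply: shift_bound.
- exact: shift_bound.
rewrite /= (@shift_coef a (shift b f)); last exact: shift_bound.
rewrite (shift_coef _ _ fN).
pose c i p q := f (N - i%:Z) *~ (binz (N - i%:Z) p * b ^+ p) *~
   (binz (N - (i + p)%N%:Z) q * a ^+ q).
transitivity (\sum_(s < k.+1) \sum_(i < s.+1) c i (s - i)%N (k - (i + (s - i)))%N).
  apply: eq_bigr => s _; rewrite /= (shift_coef _ _ fN) mulrz_suml; apply: eq_bigr => i _.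
  by rewrite /c subnKC //; have := ltn_ord i; lia.
rewrite (@sum_triangle _ _ (fun i p => c i p (k - (i + p))%N)).
apply: eq_bigr => i _.
rewrite exprDn mulr_sumr mulrz_sumr; apply: eq_bigr => p _; rewrite /c -mulrzA.
congr (_ *~ _); rewrite subnDA.
have := binz_comp (N - i%:Z) (k - i - p) p; rewrite subnK; last by have := ltn_ord p; lia.
have -> : N - i%:Z - p%:Z = N - (i + p)%N%:Z by lia.
rewrite bin_sub; last by have := ltn_ord p; lia.
rewrite -mulr_natr natz => H.
rewrite [X in _ = X](_ : _ = binz (N - i%:Z) (k - i) * 'C(k - i, p)%:Z *
  (a ^+ (k - i - p) * b ^+ p)); last by ring.
by rewrite -H; ring.
Qed.

Lemma shift0 f : shift 0 f = f.
Proof.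
apply: laurentP => m; rewrite /= /shift_fun (fsum_point (i := 0%N)).
  by rewrite addr0 binz0 expr0.
by case=> // j _; rewrite expr0n /= mulr0.
Qed.

End Shift.

Definition ladditive (R : nzRingType) (F : laurent R -> laurent R) :=
  forall f g, F (f + g) = F f + F g.

(* Operators acting on R((z^-1)), with composition as product; these contain  *)
(* multiplication by elements of R((z^-1)) and the shift operators.           *)
Record lop (R : nzRingType) := Lop {
  lop_fun :> laurent R -> laurent R;
  lop_additive : ladditive lop_fun }.

HB.instance Definition _ (R : nzRingType) := gen_eqMixin (lop R).
HB.instance Definition _ (R : nzRingType) := gen_choiceMixin (lop R).

Section OperatorRing.
Variable R : nzRingType.
Implicit Types (P Q S : lop R) (f g : laurent R).

Lemma lopP P Q : (forall f, P f = Q f) -> P = Q.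
Proof.
case: P Q => [P HP] [Q HQ] /= /funext PQ.
by subst Q; congr Lop; apply: Prop_irrelevance.
Qed.

Fact lop_zero_additive : ladditive (fun=> 0 : laurent R).
Proof. by move=> f g; rewrite addr0. Qed.
Definition lop_zero := Lop lop_zero_additive.

Fact lop_one_additive : ladditive (fun f : laurent R => f).
Proof. by []. Qed.
Definition lop_one := Lop lop_one_additive.

Fact lop_add_additive P Q : ladditive (fun f => P f + Q f).
Proof. by move=> f g; rewrite !lop_additive addrACA. Qed.
Definition lop_add P Q := Lop (lop_add_additive P Q).

Fact lop_opp_additive P : ladditive (fun f => - P f).
Proof. by move=> f g; rewrite lop_additive opprD. Qed.
Definition lop_opp P := Lop (lop_opp_additive P).

Fact lop_mul_additive P Q : ladditive (fun f => P (Q f)).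
Proof. by move=> f g; rewrite !lop_additive. Qed.
Definition lop_mul P Q := Lop (lop_mul_additive P Q).

Fact lop_addA : associative lop_add.
Proof. by move=> P Q S; apply: lopP => f /=; rewrite addrA. Qed.
Fact lop_addC : commutative lop_add.
Proof. by move=> P Q; apply: lopP => f /=; rewrite addrC. Qed.
Fact lop_add0 : left_id lop_zero lop_add.
Proof. by move=> P; apply: lopP => f /=; rewrite add0r. Qed.
Fact lop_addN : left_inverse lop_zero lop_opp lop_add.
Proof. by move=> P; apply: lopP => f /=; rewrite addNr. Qed.

HB.instance Definition _ :=
  GRing.isZmodule.Build (lop R) lop_addA lop_addC lop_add0 lop_addN.

Fact lop_mulA : associative lop_mul.
Proof. by move=> P Q S; apply: lopP. Qed.
Fact lop_mul1 : left_id lop_one lop_mul.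
Proof. by move=> P; apply: lopP. Qed.
Fact lop_mulr1 : right_id lop_one lop_mul.
Proof. by move=> P; apply: lopP. Qed.
Fact lop_mulDl : left_distributive lop_mul lop_add.
Proof. by move=> P Q S; apply: lopP. Qed.
Fact lop_mulDr : right_distributive lop_mul lop_add.
Proof. by move=> P Q S; apply: lopP => f /=; rewrite lop_additive. Qed.
Fact lop_one_neq0 : lop_one != 0 :> lop R.
Proof.
apply/eqP => /(congr1 (fun P : lop R => P 1)) /= /eqP.
by rewrite oner_eq0.
Qed.

HB.instance Definition _ := GRing.Zmodule_isNzRing.Build (lop R)
  lop_mulA lop_mul1 lop_mulr1 lop_mulDl lop_mulDr lop_one_neq0.

Fact mulop_additive f : ladditive (fun g => f * g).
Proof. by move=> g h; rewrite mulrDr. Qed.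
Definition mulop f : lop R := Lop (mulop_additive f).

(* e^(a d/dz) *)
Definition shiftop (a : int) : lop R := Lop (@shiftD R a).

Lemma shiftop_mulop a f :
  shiftop a * mulop f = mulop (shift a f) * shiftop a.
Proof. by apply: lopP => g; apply: shiftM. Qed.

Lemma shiftopD a b : shiftop (a + b) = shiftop a * shiftop b.
Proof. by apply: lopP => f; rewrite /= shift_shift. Qed.

Lemma shiftop0 : shiftop 0 = 1.
Proof. by apply: lopP => f; apply: shift0. Qed.

Fact mulop_zmod_morphism : zmod_morphism mulop.
Proof. by move=> f g; apply: lopP => h; apply: mulrBl. Qed.
Fact mulop_monoid_morphism : monoid_morphism mulop.
Proof.
split=> [|f g]; apply: lopP => h; first exact: mul1r.
by rewrite /= mulrA.
Qed.
HB.instance Definition _ :=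
  GRing.isZmodMorphism.Build (laurent R) (lop R) mulop mulop_zmod_morphism.
HB.instance Definition _ :=
  GRing.isMonoidMorphism.Build (laurent R) (lop R) mulop mulop_monoid_morphism.

End OperatorRing.

(* The product is ordered by increasing column index. *)
Definition coldet (A : nzRingType) (n : nat) (N : 'M[A]_n) : A :=
  \sum_(s : 'S_n) (-1) ^+ s * \prod_(i < n) N (s i) i.

Section Lax.
Variable R : nzRingType.

(* Series in two variables u and v live in R((v^-1))((u^-1)), that is in      *)
(* laurent (laurent R) with u as the outer variable.                          *)
Lemma in_u_bounded (f : laurent R) :
  exists N, lbound (fun m => lmon 0 (f m)) N.
Proof.
have [N fN] := lcoef_bounded f; exists N => m Nm.
by apply: laurentP => i /=; rewrite fN // if_same.
Qed.
Definition in_u (f : laurent R) : laurent (laurent R) :=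
  Laurent (in_u_bounded f).

Definition in_v (f : laurent R) : laurent (laurent R) := lmon 0 f.

(* 1/(u - v) is the sum of v^m u^(-m-1) over m >= 0. *)
Definition inv_uv_fun (i : int) : laurent R :=
  match i with
  | Posz _ => 0
  | Negz m => lmon m%:Z 1
  end.
Lemma inv_uv_bounded : exists N, lbound inv_uv_fun N.
Proof. by exists (-1); case. Qed.
Definition inv_uv : laurent (laurent R) := Laurent inv_uv_bounded.

Lemma inv_uvP : (in_u (lmon 1 1) - in_v (lmon 1 1)) * inv_uv = 1.
Proof.
have monE (S : nzRingType) m (c : S) f k :
    lmul_fun (lmon m c) f k = c * f (k - m).
  rewrite /lmul_fun (@fsum_point _ _ _ m) /= ?eqxx // => j /negPf jm.
  by rewrite jm mul0r.
have -> : in_u (lmon 1 1) = lmon 1 1.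
  apply: laurentP => m; apply: laurentP => k /=.
  by case: (m == 1) => //=; rewrite if_same.
rewrite mulrBl; apply: laurentP => k.
rewrite -[LHS]/(lmul_fun (lmon 1 1) inv_uv k -
                lmul_fun (lmon 0 (lmon 1 1)) inv_uv k).
rewrite !monE mul1r subr0; case: k => [[|k]|k].
- by rewrite mulr0 subr0.
- by have -> : Posz k.+1 - 1 = Posz k by [lia]; rewrite mulr0 subr0.
have -> : Negz k - 1 = Negz k.+1 by lia.
apply/eqP; rewrite subr_eq0; apply/eqP/laurentP => l.
rewrite -[RHS]/(lmul_fun (lmon 1 1) (lmon k 1) l) monE mul1r /=.
by congr (if _ then _ else _); lia.
Qed.

Definition yangian_lax (n : nat) (T : 'M[laurent R]_n) : Prop :=
  forall i j k l : 'I_n,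
    in_u (T i j) * in_v (T k l) - in_v (T k l) * in_u (T i j) =
    inv_uv * (in_u (T k j) * in_v (T i l) - in_v (T k j) * in_u (T i l)).

(* T(z + p) T(z + p - 1) ... T(z + 1) *)
Definition qpower (n : nat) (T : 'M[laurent R]_n) (p : nat) : 'M[laurent R]_n :=
  \prod_(i < p) map_mx (shift (p%:Z - i%:Z)) T.

Lemma qpowerE (n : nat) (T : 'M[laurent R]_n) (p : nat) :
  map_mx (@mulop R) (qpower T p) =
  shiftop R p%:Z *: map_mx (fun f => mulop f * shiftop R (-1)) T ^+ p.
Proof.
elim: p => [|p IH].
  by rewrite /qpower big_ord0 expr0 shiftop0 scale1r map_mx1.
have qS : qpower T p.+1 = map_mx (shift p.+1%:Z) T *m qpower T p.
  rewrite /qpower big_ord_recl subr0; congr (_ *m _); apply: eq_bigr => i _.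
  by congr (map_mx (shift _) T); rewrite /= /bump /=; lia.
rewrite qS exprS; apply/matrixP => i j; rewrite !mxE rmorph_sum mulr_sumr.
apply: eq_bigr => k _; rewrite rmorphM.
rewrite [map_mx (shift _) T i k]mxE /=.
have /matrixP/(_ k j) := IH; rewrite mxE [RHS]mxE => ->.
rewrite [map_mx _ T i k]mxE /= !mulrA shiftop_mulop.
rewrite -(mulrA (mulop _) (shiftop _ _) (shiftop _ _)) -shiftopD.
by have -> : p.+1%:Z - 1 = p%:Z by lia.
Qed.

End Lax.

(* Main.v *)
Require Import Defs.
From mathcomp Require Import all_boot all_order all_algebra perm.
From mathcomp Require Import reals complex.
From mathcomp Require Import zify.

Set Implicit Arguments.
Unset Strict Implicit.
Unset Printing Implicit Defensive.

Import GRing.Theory.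
Local Open Scope ring_scope.

(* Specializing the Yangian relation to u = z + 1, v = z shows that           *)
(* M = T(z) e^(-d/dz) is a Manin matrix: entries of a column commute, and the *)
(* cross commutators of every 2 x 2 minor agree. The column determinant of a  *)
(* Manin matrix is alternating in its columns, so expanding along a column    *)
(* moved to the last place gives a left adjugate B(t) with                    *)
(* B(t) (t - M) = det(t - M). Comparing coefficients of t^k yields            *)
(* h_k = B_(k-1) - B_k M, so the sum of h_k M^k telescopes to 0. As           *)
(* h_k = QH_k(z) e^((k-n) d/dz), multiplying on the left by e^(n d/dz) turns  *)
(* h_k M^k into QH_k(z+n) T^[k](z).                                           *)

(** The theorem is the Cayley-Hamilton theorem for a Manin matrix M over the operator ring, read
    back in R((z^-1)). [yangian_lax_manin] gives the Manin property, [worddet_swap] and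
    [worddet_repeat] the alternation of the column determinant, [manin_left_adjugate] the adjugate,
    and [manin_Cayley_Hamilton] the operator identity. [qpowerE] turns powers of M into quantum
    powers, and a multiplication operator determines its series. *)

Section Manin.

(** * Column determinants of Manin matrices and the left adjugate *)

Variable A : nzRingType.

(* For j = l the second condition only says that twice the commutator in the *)
(* first one vanishes, hence the separate first condition.                    *)
Definition manin (m n : nat) (N : 'M[A]_(m, n)) : Prop :=
  (forall i k j, N i j * N k j = N k j * N i j) /\
  (forall i j k l,
     N i j * N k l - N k l * N i j = N k j * N i l - N i l * N k j).

(** Terms cancel in pairs of opposite sign, so no division by 2 is needed. *)
Lemma sum_sign_tperm n (a b : 'I_n) (F : 'S_n -> A) : a != b ->
  (forall s, F (tperm a b * s)%g = F s) -> \sum_(s : 'S_n) (-1) ^+ s * F s = 0.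
Proof.
move=> ab FE; rewrite (bigID (@odd_perm _)) /=.
rewrite [X in _ + X](reindex_inj (mulgI (tperm a b))) /=.
rewrite [X in _ + X](eq_bigl (fun s : 'S_n => odd_perm s)); last first.
  by move=> s; rewrite odd_permM odd_tperm ab negbK.
rewrite -big_split big1 //= => s os.
by rewrite FE odd_permM odd_tperm ab os /= mulN1r mul1r addNr.
Qed.

Lemma prod_split_adjacent n (G : 'I_n.+1 -> A) a : (a.+1 < n.+1)%N ->
  \prod_(k < n.+1) G k =
  (\prod_(0 <= k < a) G (inord k)) * (G (inord a) * G (inord a.+1)) *
  (\prod_(a.+2 <= k < n.+1) G (inord k)).
Proof.
move=> an; rewrite (eq_bigr (fun k : 'I_n.+1 => G (inord k))); last first.
  by move=> k _; rewrite inord_val.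
rewrite -(big_mkord xpredT (fun k => G (inord k))).
rewrite (@big_cat_nat _ _ _ a) //=; last by lia.
rewrite (@big_ltn _ _ _ a); last by lia.
by rewrite (@big_ltn _ _ _ a.+1) // !mulrA.
Qed.

(* The column determinant of the matrix whose columns are those of N listed   *)
(* by the word w.                                                             *)
Definition worddet n (N : 'M[A]_n.+1) (w : seq 'I_n.+1) : A :=
  coldet (\matrix_(i, k) N i (nth ord0 w k)).

Section Word.
Variables (n : nat) (N : 'M[A]_n.+1).
Hypothesis maninN : manin N.

(** Transposing two adjacent places touches only the middle factor [X], so the cancellation survives
    although the entries do not commute. *)
Lemma sum_sign_adjacent (a : nat) (P Q : nat -> 'I_n.+1)
    (X : 'I_n.+1 -> 'I_n.+1 -> A) :
  (a.+1 < n.+1)%N -> (forall i k, X i k = X k i) ->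
  \sum_(s : 'S_n.+1) (-1) ^+ s *
    ((\prod_(0 <= k < a) N (s (inord k)) (P k)) *
     X (s (inord a)) (s (inord a.+1)) *
     (\prod_(a.+2 <= k < n.+1) N (s (inord k)) (Q k))) = 0.
Proof.
move=> an XC; apply: (@sum_sign_tperm _ (inord a) (inord a.+1)).
  by apply/eqP => /(congr1 val); rewrite /= !inordK //; lia.
move=> s; congr (_ * _ * _).
- apply: eq_big_nat => k kn; rewrite permM tpermD //;
    by apply/eqP => /(congr1 val); rewrite /= !inordK //; lia.
- by rewrite !permM tpermL tpermR XC.
- apply: eq_big_nat => k kn; rewrite permM tpermD //;
    by apply/eqP => /(congr1 val); rewrite /= !inordK //; lia.
Qed.

Lemma worddet_split (w : seq 'I_n.+1) (a : nat) : (a.+1 < n.+1)%N ->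
  worddet N w = \sum_(s : 'S_n.+1) (-1) ^+ s *
    ((\prod_(0 <= k < a) N (s (inord k)) (nth ord0 w k)) *
     (N (s (inord a)) (nth ord0 w a) * N (s (inord a.+1)) (nth ord0 w a.+1)) *
     (\prod_(a.+2 <= k < n.+1) N (s (inord k)) (nth ord0 w k))).
Proof.
move=> an; apply: eq_bigr => s _; congr (_ * _).
rewrite (prod_split_adjacent _ an).
congr (_ * _ * _); last 1 first.
- by apply: eq_big_nat => k kn; rewrite !mxE inordK //; lia.
- by apply: eq_big_nat => k kn; rewrite !mxE inordK //; lia.
- by rewrite !mxE !inordK //; lia.
Qed.

(** In the sum of the two determinants the middle factor is N_ia N_kb + N_ib N_ka, and the cross
    relation says exactly that it is symmetric in i and k. *)
Lemma worddet_swap u v a b : (size u + size v).+2 = n.+1 ->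
  worddet N (u ++ [:: a, b & v]) = - worddet N (u ++ [:: b, a & v]).
Proof.
move=> sz; have an : ((size u).+1 < n.+1)%N by lia.
apply/eqP; rewrite -subr_eq0 opprK !(worddet_split _ an) -big_split /=.
pose P k := nth ord0 (u ++ [:: a, b & v]) k.
have PE k : (k < size u)%N || ((size u).+2 <= k)%N ->
    nth ord0 (u ++ [:: b, a & v]) k = P k.
  rewrite /P !nth_cat => /orP[-> //|k2].
  have -> : (k < size u)%N = false by lia.
  by have -> : (k - size u = (k - size u).-2.+2)%N by lia.
apply/eqP; rewrite -[RHS](@sum_sign_adjacent (size u) P P
  (fun i k => N i a * N k b + N i b * N k a)) //; last first.
  move=> i k; have [_ /(_ i a k b)] := maninN.
  move/eqP; rewrite subr_eq addrAC -subr_eq0 => /eqP H.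
  apply/eqP; rewrite -subr_eq0; apply/eqP; rewrite -[RHS]H.
  by rewrite !opprD !opprK !addrA (ACl (1*3*4*2)).
apply: eq_bigr => s _; rewrite -mulrDr; congr (_ * _).
rewrite mulrDr mulrDl; congr (_ * _ * _ + _).
  by rewrite !nth_cat ltnn ltnNge leqnSn subnn subSn ?subnn //=.
congr (_ * _ * _).
- by apply: eq_big_nat => k kn; rewrite PE //; lia.
- by rewrite !nth_cat ltnn ltnNge leqnSn subnn subSn ?subnn //=.
- by apply: eq_big_nat => k kn; rewrite PE //; lia.
Qed.

(** [worddet_swap] would only show that twice this determinant vanishes; commutation within a column
    makes the middle factor symmetric directly. *)
Lemma worddet_repeat u v a : (size u + size v).+2 = n.+1 ->
  worddet N (u ++ [:: a, a & v]) = 0.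
Proof.
move=> sz; have an : ((size u).+1 < n.+1)%N by lia.
rewrite (worddet_split _ an).
rewrite -[RHS](@sum_sign_adjacent (size u) (nth ord0 (u ++ [:: a, a & v]))
  (nth ord0 (u ++ [:: a, a & v])) (fun i k => N i a * N k a)) //; last first.
  by move=> i k; apply: maninN.1.
apply: eq_bigr => s _; congr (_ * (_ * _ * _)).
by rewrite !nth_cat ltnn ltnNge leqnSn subnn subSn ?subnn //=.
Qed.

Lemma worddet_move u v x a : (size u + size v + size x).+1 = n.+1 ->
  worddet N (u ++ a :: v ++ x) = (-1) ^+ size v * worddet N (u ++ v ++ a :: x).
Proof.
elim: v u => [|b v IH] u sz; first by rewrite expr0 mul1r.
rewrite /= in sz *; rewrite worddet_swap; last by rewrite size_cat; lia.
rewrite -cat_rcons IH; last by rewrite size_rcons; lia.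
by rewrite cat_rcons exprS mulN1r mulNr.
Qed.

Lemma worddet_rcons_mem w j : size w = n -> j \in w ->
  worddet N (rcons w j) = 0.
Proof.
move=> sz jw; case/splitPr: jw sz => u v; rewrite size_cat /= => sz.
rewrite -cats1 -catA /= worddet_move /=; last by lia.
by rewrite catA worddet_repeat ?mulr0 // size_cat /=; lia.
Qed.

(** Grouping permutations by the row used in the last column leaves that entry rightmost in each
    product; hence the cofactors are left coefficients, the same for every j. *)
Lemma worddet_rcons w : size w = n ->
  {C : 'I_n.+1 -> A | forall j, worddet N (rcons w j) = \sum_l C l * N l j}.
Proof.
move=> sz; exists (fun l => \sum_(s : 'S_n.+1 | s ord_max == l) (-1) ^+ s *
  \prod_(k < n) N (s (widen_ord (leqnSn n) k)) (nth ord0 w k)) => j.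
rewrite /worddet /coldet (partition_big (fun s : 'S_n.+1 => s ord_max) xpredT) //=.
apply: eq_bigr => l _; rewrite mulr_suml; apply: eq_bigr => s /eqP sl.
rewrite big_ord_recr /= -!mulrA; congr (_ * (_ * _)).
  by apply: eq_bigr => k _; rewrite mxE nth_rcons sz /= ltn_ord.
by rewrite mxE sl nth_rcons sz /= ltnn eqxx.
Qed.

Lemma worddet_enum : worddet N (enum 'I_n.+1) = coldet N.
Proof. by congr coldet; apply/matrixP => i k; rewrite mxE nth_ord_enum. Qed.

End Word.

Lemma manin_left_adjugate n (N : 'M[A]_n) : manin N ->
  {B : 'M[A]_n | B *m N = (coldet N)%:M}.
Proof.
case: n N => [|n] N mN; first by exists 0; rewrite !flatmx0.
pose e := enum 'I_n.+1; pose w i := rem i e.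
have szw i : size (w i) = n by rewrite size_rem ?mem_enum // size_enum_ord.
(* Row i holds the cofactors of all columns but i. Appending column j repeats a column if j differs
   from i; for j = i, moving it back to its place crosses n - i columns, whence the sign. *)
pose B (i l : 'I_n.+1) := (-1) ^+ (n - i) * sval (worddet_rcons N (szw i)) l.
exists (\matrix_(i, l) B i l); apply/matrixP => i j; rewrite !mxE.
transitivity ((-1) ^+ (n - i) * worddet N (rcons (w i) j)).
  rewrite (svalP (worddet_rcons N (szw i))) mulr_sumr.
  by apply: eq_bigr => l _; rewrite mxE mulrA.
case: eqVneq => [<-|ij]; last first.
  rewrite worddet_rcons_mem ?mulr0 // mem_rem_uniq ?enum_uniq //.
  by rewrite inE eq_sym ij mem_enum.
have ie : i \in e by rewrite mem_enum.
have : index i e = i by rewrite index_enum_ord.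
have : size e = n.+1 by rewrite size_enum_ord.
rewrite mulr1n -worddet_enum -/e /w.
have := enum_uniq 'I_n.+1; rewrite -/e.
case/splitPr: ie => u v ue sz ix.
have iu : i \notin u.
  by apply/negP => iu; move: ue; rewrite cat_uniq /= iu /= andbF.
rewrite size_cat /= in sz.
rewrite index_cat (negPf iu) /= eqxx addn0 in ix.
have -> : rem i (u ++ i :: v) = u ++ v.
  elim: u iu {ue sz ix} => [|b u IH] /=; first by rewrite eqxx.
  by rewrite inE negb_or eq_sym => /andP[/negPf -> /IH ->].
rewrite -[in RHS](cats0 v) worddet_move //; last by rewrite /=; lia.
by rewrite cats1 -rcons_cat -ix; congr (_ ^+ _ * _); lia.
Qed.

End Manin.

(** * Cayley-Hamilton for Manin matrices *)

(** The entries of 'X%:M are central, so subtracting M from it leaves the commutators of entries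
    unchanged. *)
Lemma manin_charpoly (A : nzRingType) n (M : 'M[A]_n) :
  manin M -> manin ('X%:M - map_mx polyC M).
Proof.
case=> col cross.
have XN i j (q : {poly A}) : GRing.comm ('X *+ (i == j :> 'I_n)) q.
  by apply/commr_sym/commrMn/commr_polyX.
have comm_diff (x y a b : {poly A}) : (forall q, GRing.comm x q) ->
    (forall q, GRing.comm y q) ->
    (x - a) * (y - b) - (y - b) * (x - a) = a * b - b * a.
  move=> cx cy; rewrite !mulrBl !mulrBr (cx y) (cx b) (cy a).
  by rewrite !opprB !addrA (ACl ((1*8)*(2*5)*(4*7)*3*6)) /= subrr !addNr !add0r.
split=> [i k j|i j k l]; rewrite !mxE; last first.
  by rewrite !comm_diff // -!rmorphM -!rmorphB cross.
by apply/eqP; rewrite -subr_eq0 comm_diff // -!rmorphM col subrr.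
Qed.

Theorem manin_Cayley_Hamilton (A : nzRingType) n (M : 'M[A]_n) d : manin M ->
  let p := coldet ('X%:M - map_mx polyC M) in
  (size p <= d)%N -> \sum_(k < d) p`_k *: M ^+ k = 0.
Proof.
move=> mM p pd; have [B BN] := manin_left_adjugate (manin_charpoly mM).
(* The index is off by one: [Bc k] is the coefficient of degree k - 1 of B, so the telescoping sum
   starts at 0. *)
pose Bc k := if k is k'.+1 then map_mx (fun q : {poly A} => q`_k') B else 0.
have BcE k : Bc k - Bc k.+1 *m M = (p`_k)%:M.
  apply/matrixP => i j; rewrite [RHS]mxE -coefMn.
  have <- : (B *m ('X%:M - map_mx polyC M)) i j = p *+ (i == j) by rewrite BN mxE.
  have -> : (B *m ('X%:M - map_mx polyC M)) i j =
            B i j * 'X - \sum_l B i l * (M l j)%:P.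
    rewrite mulmxBr !mxE; congr (_ - _); last by apply: eq_bigr => l _; rewrite mxE.
    rewrite (bigD1 j) //= big1 ?addr0 => [|l /negPf lj]; first by rewrite mxE eqxx.
    by rewrite mxE lj mulr0.
  rewrite coefB coefMX coef_sum mxE; congr (_ + _).
    by case: k => [|k]; rewrite !mxE.
  by rewrite !mxE; congr (- _); apply: eq_bigr => l _; rewrite coefMC mxE.
(* Beyond [d] the coefficients of p vanish, and the second summand puts D past every degree in B, so
   the top term [Bc D] vanishes too. *)
pose D := (d + \max_i \max_j size (B i j)).+1.
have BD : Bc D = 0.
  apply/matrixP => i j; rewrite !mxE nth_default //.
  apply: leq_trans (leq_addl _ _).
  exact: leq_trans (leq_bigmax j) (leq_bigmax i).
have -> : \sum_(k < d) p`_k *: M ^+ k = \sum_(0 <= k < D) p`_k *: M ^+ k.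
  rewrite -(big_mkord xpredT (fun k => p`_k *: M ^+ k)).
  rewrite [RHS](@big_cat_nat _ _ _ d) //=; last by rewrite /D; lia.
  rewrite [X in _ = _ + X]big_nat_cond [X in _ = _ + X]big1 ?addr0 // => k.
  case/andP=> /andP[dk _] _.
  by rewrite nth_default ?scale0r // (leq_trans pd).
rewrite (eq_bigr (fun k => - (Bc k.+1 *m M ^+ k.+1 - Bc k *m M ^+ k))).
  by rewrite sumrN telescope_sumr // BD !mul0mx subrr oppr0.
move=> k _; rewrite -mul_scalar_mx -BcE mulmxBl opprB exprS.
by rewrite -[M * _]/(M *m _) mulmxA.
Qed.

(** * The substitution u = z + 1, v = z in double Laurent series *)

Section Evaluation.
Variable R : nzRingType.
Implicit Types f g : laurent R.

(* With G s r the coefficient of u^(N - s) v^(N - r), this is the coefficient *)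
(* of z^(2 N - k) after the substitution u = z + 1, v = z.                    *)
Definition diag_eval (N : int) (G : nat -> nat -> R) (k : nat) : R :=
  \sum_(s < k.+1) \sum_(t < (k - s).+1) G s (k - s - t)%N *~ binz (N - s%:Z) t.

Lemma diag_evalB N G H k :
  diag_eval N (fun s r => G s r - H s r) k = diag_eval N G k - diag_eval N H k.
Proof.
rewrite /diag_eval -sumrB; apply: eq_bigr => s _.
by rewrite -sumrB; apply: eq_bigr => t _; rewrite mulrzBl.
Qed.

Lemma diag_eval_mull N f g k : lbound f N -> lbound g N ->
  (shift 1 f * g) (N + N - k%:Z) =
  diag_eval N (fun s r => f (N - s%:Z) * g (N - r%:Z)) k.
Proof.
move=> fN gN; have sN := @shift_bound _ 1 f N fN.
rewrite -[LHS]/(lmul_fun (shift 1 f) g _) lmul_funE //.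
rewrite /diag_eval -(@sum_triangle _ k (fun s t =>
  (f (N - s%:Z) * g (N - (k - s - t)%N%:Z)) *~ binz (N - s%:Z) t)).
apply: eq_bigr => j _; rewrite /= shift_coef // mulr_suml.
apply: eq_bigr => s _; rewrite expr1n mulr1 mulrzAl.
by congr ((_ * g (_ - _)) *~ _); have := ltn_ord s; lia.
Qed.

Lemma diag_eval_mulr N f g k : lbound f N -> lbound g N ->
  (g * shift 1 f) (N + N - k%:Z) =
  diag_eval N (fun s r => g (N - r%:Z) * f (N - s%:Z)) k.
Proof.
move=> fN gN; have sN := @shift_bound _ 1 f N fN.
rewrite -[LHS]/(lmul_fun g (shift 1 f) _) lmul_funE //.
rewrite /diag_eval -(@sum_triangle _ k (fun s t =>
  (g (N - (k - s - t)%N%:Z) * f (N - s%:Z)) *~ binz (N - s%:Z) t)).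
rewrite (reindex_inj rev_ord_inj) /=.
apply: eq_bigr => j _; rewrite subSS subKn; last by have := ltn_ord j; lia.
rewrite shift_coef // mulr_sumr.
apply: eq_bigr => s _; rewrite expr1n mulr1 mulrzAr.
by congr ((g (_ - _) * _) *~ _); have := ltn_ord s; lia.
Qed.

(* The factor u - v becomes (z + 1) - z = 1. *)
Lemma diag_eval_uv N G H k :
  (forall r, G 0%N r = 0) -> (forall s, G s 0%N = 0) ->
  (forall s r, G s.+1 r - G s r.+1 = H s r) ->
  diag_eval N H k = diag_eval N G k.
Proof.
(* X evaluates (u - v) G, using (z + 1)^(m+1) - z (z + 1)^m. Distributing the difference and
   reindexing gives H; Pascal's rule [binzS] gives G. The boundary terms vanish by [G0] and
   [Gr0]. *)
move=> G0 Gr0 GH; pose X := \sum_(s < k.+2) \sum_(t < (k.+1 - s).+1)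
  G s (k.+1 - s - t)%N *~ (binz (N - s%:Z + 1) t - binz (N - s%:Z) t).
transitivity X.
  rewrite /X (eq_bigr (fun s : 'I_k.+2 =>
     \sum_(t < (k.+1 - s).+1) G s (k.+1 - s - t)%N *~ binz (N - s%:Z + 1) t -
     \sum_(t < (k.+1 - s).+1) G s (k.+1 - s - t)%N *~ binz (N - s%:Z) t)).
    rewrite sumrB big_ord_recl big1 => [|t _]; last by rewrite G0 mul0rz.
    rewrite add0r [X in _ = _ - X]big_ord_recr /= subnn big_ord1 Gr0 mul0rz addr0.
    rewrite -sumrB; apply: eq_bigr => s _; rewrite /bump /= add1n subSS.
    rewrite subSn; last by have := ltn_ord s; lia.
    rewrite [X in _ = _ - X]big_ord_recr /= subnn Gr0 mul0rz addr0 -sumrB.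
    apply: eq_bigr => t _; rewrite -GH mulrzBl; congr (_ *~ binz _ _ - G _ _ *~ _).
      by lia.
    by have := ltn_ord t; lia.
  by move=> s _; rewrite -sumrB; apply: eq_bigr => t _; rewrite mulrzBr.
rewrite /X big_ord_recr /= subnn big_ord1 Gr0 mul0rz addr0.
apply: eq_bigr => s _; rewrite subSn; last by have := ltn_ord s; lia.
rewrite big_ord_recl !binz0 subrr mulr0z add0r; apply: eq_bigr => t _.
by rewrite lift0 binzS addrAC subrr add0r subSS.
Qed.

Lemma lmul_monl (S : nzRingType) m (c : S) (f : laurent S) k :
  (lmon m c * f) k = c * f (k - m).
Proof.
rewrite -[LHS]/(lmul_fun (lmon m c) f k) /lmul_fun (@fsum_point _ _ _ m) /=.
  by rewrite eqxx.
by move=> j /negPf jm; rewrite jm mul0r.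
Qed.

Lemma lmul_monr (S : nzRingType) m (c : S) (f : laurent S) k :
  (f * lmon m c) k = f (k - m) * c.
Proof.
rewrite -[LHS]/(lmul_fun f (lmon m c) k) /lmul_fun (@fsum_point _ _ _ (k - m)) /=.
  by have -> : k - (k - m) = m by [lia]; rewrite eqxx.
move=> j jm; have /negPf-> : k - j != m by apply: contraNneq jm; lia.
by rewrite mulr0.
Qed.

Lemma in_uvE f g p q : (in_u f * in_v g) p q = f p * g q.
Proof.
by rewrite (lmul_monr 0 g (in_u f) p) subr0 (lmul_monl 0 (f p) g q) subr0.
Qed.

Lemma in_vuE f g p q : (in_v g * in_u f) p q = g q * f p.
Proof.
by rewrite (lmul_monl 0 g (in_u f) p) subr0 (lmul_monr 0 (f p) g q) subr0.
Qed.

Lemma in_u_mon1 : in_u (lmon 1 1) = lmon 1 1 :> laurent (laurent R).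
Proof.
by apply: laurentP => m; apply: laurentP => k /=; case: (m == 1) => //=;
  rewrite if_same.
Qed.

(** The denominator is cleared before substituting: the series of 1/(u - v) has no value at u = z +
    1, v = z, since each term z^m (z + 1)^(-m-1) contributes to z^(-1). *)
Lemma yangian_lax_coef n (T : 'M[laurent R]_n) : yangian_lax T ->
  forall (i j k l : 'I_n) p q,
    (T i j (p - 1) * T k l q - T k l q * T i j (p - 1)) -
    (T i j p * T k l (q - 1) - T k l (q - 1) * T i j p) =
    T k j p * T i l q - T k j q * T i l p.
Proof.
move=> hT i j k l p q.
have coefBB (h h' : laurent (laurent R)) a b : (h - h') a b = h a b - h' a b by [].
have uE (h : laurent (laurent R)) : (in_u (lmon 1 1) * h) p q = h (p - 1) q.
  by rewrite in_u_mon1 (lmul_monl 1 1 h p) mul1r.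
have vE (h : laurent (laurent R)) : (in_v (lmon 1 1) * h) p q = h p (q - 1).
  by rewrite (lmul_monl 0 _ h p) subr0 (lmul_monl 1 1 (h p) q) mul1r.
pose D := in_u (T i j) * in_v (T k l) - in_v (T k l) * in_u (T i j).
have DE a b : T i j a * T k l b - T k l b * T i j a = D a b.
  by rewrite coefBB (in_uvE (T i j) (T k l)) (in_vuE (T i j) (T k l)).
rewrite !DE -uE -vE -coefBB -mulrBl /D hT mulrA inv_uvP mul1r coefBB.
by rewrite (in_uvE (T k j) (T i l)) (in_vuE (T i l) (T k j)).
Qed.

(* Specialization of the relation to u = z + 1, v = z. *)
Lemma yangian_lax_eval n (T : 'M[laurent R]_n) : yangian_lax T ->
  forall i j k l : 'I_n,
    shift 1 (T i j) * T k l - T k l * shift 1 (T i j) =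
    shift 1 (T k j) * T i l - T k j * shift 1 (T i l).
Proof.
move=> hT i j k l.
have [N0 [ij0 kl0]] := lbound2 (T i j) (T k l).
have [N1 [kj1 il1]] := lbound2 (T k j) (T i l).
(* The extra 1 makes the coefficients at N vanish, as the boundary hypotheses of [diag_eval_uv]
   require. *)
pose N := Num.max N0 N1 + 1.
have N01 : N0 <= N /\ N1 <= N by rewrite /N; lia.
have N0' : N0 < N by rewrite /N; lia.
have ijN := lbound_le N01.1 ij0; have klN := lbound_le N01.1 kl0.
have kjN := lbound_le N01.2 kj1; have ilN := lbound_le N01.2 il1.
have subN (h h' : laurent R) m : (h - h') m = h m - h' m by [].
have bndB (h h' : laurent R) : lbound h (N + N) -> lbound h' (N + N) ->
    lbound (h - h') (N + N).
  by move=> hN h'N m Nm; rewrite subN hN // h'N // subr0.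
have bndM (h h' : laurent R) : lbound h N -> lbound h' N -> lbound (h * h') (N + N).
  exact: lmul_fun_bound.
have bndS (h : laurent R) : lbound h N -> lbound (shift 1 h) N.
  exact: shift_bound.
apply: (@laurent_ext _ (N + N)) => [||m].
- by apply: bndB; apply: bndM => //; apply: bndS.
- by apply: bndB; apply: bndM => //; apply: bndS.
rewrite [LHS]subN [RHS]subN (diag_eval_mull m ijN klN) (diag_eval_mulr m ijN klN).
rewrite (diag_eval_mull m kjN ilN) (diag_eval_mulr m ilN kjN) -!diag_evalB.
apply/esym/diag_eval_uv => [r|s|s r].
- by rewrite subr0 ij0 // mul0r mulr0 subr0.
- by rewrite subr0 kl0 // mul0r mulr0 subr0.
have := yangian_lax_coef hT i j k l (N - s%:Z) (N - r%:Z).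
have -> : N - s%:Z - 1 = N - s.+1%:Z by lia.
by have -> : N - r%:Z - 1 = N - r.+1%:Z by lia.
Qed.

(** * From the Yangian relation to the Manin property *)

(** Every product of two entries is T_ij(z) T_kl(z - 1) followed by the same shift by -2, so the
    evaluated relation at u = z, v = z - 1 suffices. *)
Lemma yangian_lax_manin n (T : 'M[laurent R]_n) : yangian_lax T ->
  manin (map_mx (fun f => mulop f * shiftop R (-1)) T).
Proof.
move=> hT.
pose M := map_mx (fun f => mulop f * shiftop R (-1)) T.
have MM i j k l :
    M i j * M k l = mulop (T i j * shift (-1) (T k l)) * shiftop R (-2).
  rewrite [M i j]mxE [M k l]mxE mulrA -(mulrA (mulop (T i j))) shiftop_mulop.
  by rewrite mulrA -rmorphM -mulrA -shiftopD.
have shiftV (f g : laurent R) : shift (-1) (shift 1 f * g) = f * shift (-1) g.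
  by rewrite shiftM shift_shift shift0.
have shiftVr (f g : laurent R) : shift (-1) (g * shift 1 f) = shift (-1) g * f.
  by rewrite shiftM shift_shift shift0.
have shiftB (f g : laurent R) : shift (-1) (f - g) = shift (-1) f - shift (-1) g.
  by apply: (addIr (shift (-1) g)); rewrite -shiftD !subrK.
have rel i j k l : T i j * shift (-1) (T k l) - shift (-1) (T k l) * T i j =
    T k j * shift (-1) (T i l) - shift (-1) (T k j) * T i l.
  by have /(congr1 (shift (-1))) := yangian_lax_eval hT i j k l;
    rewrite [LHS]shiftB [RHS]shiftB [in LHS]shiftV [in RHS]shiftV
      [in LHS]shiftVr [in RHS]shiftVr.
(* Two instances of [rel] are combined so that the products with the shifted factor on the left
   cancel. *)
have cross i j k l :
    T i j * shift (-1) (T k l) - T k l * shift (-1) (T i j) =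
    T k j * shift (-1) (T i l) - T i l * shift (-1) (T k j).
  have -> : T k l * shift (-1) (T i j) =
      T i l * shift (-1) (T k j) - shift (-1) (T i l) * T k j
      + shift (-1) (T i j) * T k l by rewrite -rel subrK.
  have -> : T k j * shift (-1) (T i l) =
      T i j * shift (-1) (T k l) - shift (-1) (T i j) * T k l
      + shift (-1) (T i l) * T k j by rewrite -rel subrK.
  by rewrite !(opprD, opprK, addrA) (ACl (1*4*3*2)).
split=> [i k j|i j k l]; rewrite -/M.
  (* For l = j the same product is subtracted on both sides of [rel]. *)
  by rewrite (MM i j k j) (MM k j i j); have /addIr -> := rel i j k j.
rewrite (MM i j k l) (MM k l i j) (MM k j i l) (MM i l k j).
have mulopB (f g : laurent R) P : mulop f * P - mulop g * P = mulop (f - g) * P.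
  by rewrite rmorphB mulrBl.
apply: etrans (mulopB _ _ _) (etrans _ (esym (mulopB _ _ _))).
by rewrite cross.
Qed.

End Evaluation.

Theorem proposition9 (K : realType) (R : algType K[i]) (n : nat)
    (T : 'M[laurent R]_n) (QH : 'I_n.+1 -> laurent R)
    (hT : yangian_lax T)
    (hQH : coldet ('X%:M - map_mx (fun f => (mulop f * shiftop R (-1))%:P) T) =
           \sum_(k < n.+1) 'X^k * (mulop (QH k) * shiftop R (k%:Z - n%:Z))%:P) :
  \sum_(k < n.+1) shift n%:Z (QH k) *: qpower T k = 0.
Proof.
pose M := map_mx (fun f => mulop f * shiftop R (-1)) T.
pose c k := mulop (QH k) * shiftop R (k%:Z - n%:Z).
have pE : coldet ('X%:M - map_mx polyC M) = \poly_(k < n.+1) c (inord k).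
  have -> : map_mx polyC M = map_mx (fun f => (mulop f * shiftop R (-1))%:P) T.
    by apply/matrixP => i j; rewrite !mxE.
  rewrite hQH poly_def; apply: eq_bigr => k _.
  by rewrite inord_val -mul_polyC; apply/esym/commr_polyXn.
have := manin_Cayley_Hamilton (d := n.+1) (yangian_lax_manin hT).
rewrite /= -/M pE => /(_ (size_poly _ _)) CH.
(* Applying a multiplication operator to 1 recovers its series, so the identity may be checked among
   operators. *)
have mulop_inj : injective (@mulop R).
  by move=> f g /(congr1 (fun P : lop R => P 1)) /=; rewrite !mulr1.
suff E : map_mx (@mulop R) (\sum_(k < n.+1) shift n%:Z (QH k) *: qpower T k) = 0.
  apply/matrixP => i j; apply: mulop_inj; rewrite [in RHS]mxE raddf0.
  by have /matrixP/(_ i j) := E; rewrite mxE [RHS]mxE.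
rewrite raddf_sum.
transitivity (shiftop R n%:Z *:
  \sum_(k < n.+1) (\poly_(k < n.+1) c (inord k))`_k *: M ^+ k).
  rewrite scaler_sumr; apply: eq_bigr => k _.
  rewrite coef_poly ltn_ord inord_val scalerA /c mulrA shiftop_mulop -mulrA -shiftopD.
  (* What remains is the shift by k, which [qpowerE] needs to turn M^k into the quantum power. *)
  have -> : n%:Z + (k%:Z - n%:Z) = k%:Z by lia.
  rewrite -scalerA -qpowerE; apply/matrixP => i j.
  by rewrite !mxE; apply: (rmorphM (@mulop R)).
by rewrite CH scaler0.
Qed.
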